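(* Let $X$ be a set. For $i\in\{1,2\}$ let $H_i$ be a finite-dimensional real vector space, $h_i:X\to H_i$ a map, and $V_i\subset H_i^*$ a linear subspace. Assume that the two pairs realize the same finite-dimensional concept family, $\mathcal{C}_1=\mathcal{C}_2=:\mathcal{C}$, and that the evaluation maps $E_1$ and $E_2$ are injective. Then: (1) For each $i\in\{1,2\}$ there exists a unique linear map $Q_i:H_i\to\mathcal{C}^*$ satisfying $Q_i(v)(E_i(\ell))=\ell(v)$ for all $v\in H_i$ and all $\ell\in V_i$. In particular, $Q_i(h_i(x))=\operatorname{ev}_x$ for all $x\in X$. (2) The kernel of $Q_i$ is exactly $K(V_i)$. (3) The induced map $\overline{Q}_i:Z(V_i)=H_i/K(V_i)\to\mathcal{C}^*$ is a linear isomorphism. Consequently the quotients of the two models are canonically isomorphic to the same space $\mathcal{C}^*$: $H_1/K(V_1)\cong\mathcal{C}^*\cong H_2/K(V_2)$ via $\overline{Q}_1$ and $\overline{Q}_2$. Because $\mathcal{C}$ is finite-dimensional, the canonical bidual identification also gives $\mathcal{C}\cong(\mathcal{C}^* )^*$.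
   Context: For $i\in\{1,2\}$, the concept family is $\mathcal{C}_i=\{\ell\circ h_i:\ell\in V_i\}\subset\mathbb{R}^X$ and the evaluation map is $E_i:V_i\to\mathcal{C}_i$, $E_i(\ell)=\ell\circ h_i$. For a subspace $V\subset H^*$, the probe-invisible subspace is $K(V)=\bigcap_{\ell\in V}\ker\ell\subset H$ and the probe-visible quotient is $Z(V)=H/K(V)$. For $x\in X$, $\operatorname{ev}_x\in\mathcal{C}^*$ is $\operatorname{ev}_x(c)=c(x)$. Stars denote (algebraic) dual spaces. *)

(* Defs.v *)
From HB Require Import structures.
From mathcomp Require Import all_boot all_order all_algebra.
From mathcomp Require Import generic_quotient ring_quotient.
From mathcomp Require Import boolp classical_sets functions reals.

Set Implicit Arguments.
Unset Strict Implicit.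
Unset Printing Implicit Defensive.

Import GRing.Theory.

Local Open Scope ring_scope.
Local Open Scope quotient_scope.

(* MathComp's [submodClosed] structure does not provide closure under opposite,
   and [{vspace _}] requires a finite-dimensional ambient space; function spaces
   [X -> R] need neither restriction. *)
Record subspace (R : pzRingType) (U : lmodType R) := Subspace {
  subspace_pred :> {pred U} ;
  subspaceP : submod_closed subspace_pred
}.

HB.instance Definition _ (R : pzRingType) (U : lmodType R) (S : subspace U) :=
  GRing.isSubmodClosed.Build R U (subspace_pred S) (subspaceP S).

Section SubspaceType.
Variables (R : pzRingType) (U : lmodType R) (S : subspace U).

Record subspace_of : predArgType :=
  SubspaceOf { subspace_val : U ; subspace_valP : subspace_val \in S }.

HB.instance Definition _ := [isSub of subspace_of for subspace_val].
HB.instance Definition _ := [Choice of subspace_of by <:].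
HB.instance Definition _ := [SubChoice_isSubZmodule of subspace_of by <:].
HB.instance Definition _ := [SubZmodule_isSubLmodule of subspace_of by <:].

End SubspaceType.

Section QuotientModule.
Variables (R : pzRingType) (U : lmodType R) (S : subspace U).

Definition quot_space := Quotient.quot (subspace_pred S).

HB.instance Definition _ := ZmodQuotient.on quot_space.

Definition quot_scale (a : R) (q : quot_space) : quot_space :=
  \pi_quot_space (a *: repr q).

Lemma pi_scale a u :
  \pi_quot_space (a *: u) = quot_scale a (\pi_quot_space u).
Proof.
apply/eqP; rewrite -Quotient.idealrBE -scalerBr rpredZ //.
by rewrite Quotient.idealrBE reprK.
Qed.

Lemma quot_scaleA a b q : quot_scale a (quot_scale b q) = quot_scale (a * b) q.
Proof.
by elim/quotW: q => u; rewrite -(pi_scale b u) -!(pi_scale _ _) scalerA.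
Qed.

Lemma quot_scale1 : left_id 1 quot_scale.
Proof. by elim/quotW => u; rewrite -(pi_scale 1 u) scale1r. Qed.

Lemma quot_scaleDr : right_distributive quot_scale +%R.
Proof.
move=> a; elim/quotW=> u; elim/quotW=> v.
by rewrite -raddfD -!(pi_scale a _) -raddfD scalerDr.
Qed.

Lemma quot_scaleDl q : {morph quot_scale^~ q : a b / a + b}.
Proof.
by elim/quotW: q => u a b; rewrite -!(pi_scale _ u) -raddfD scalerDl.
Qed.

HB.instance Definition _ := GRing.Zmodule_isLmodule.Build R quot_space
  quot_scaleA quot_scale1 quot_scaleDr quot_scaleDl.

End QuotientModule.

Section Dual.
Variables (R : comPzRingType) (U : lmodType R).

(* The algebraic dual of an arbitrary module; the library's ['Hom(_, _)] is
   restricted to finite-dimensional spaces, which [subspace_of C] below is not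
   declared to be. *)
Definition dual := {linear U -> R^o}.

Definition linear_functional : {pred U -> R^o} := fun f => `[< linear f >].

Section Sub.
Variables (f : U -> R^o) (fP : f \in linear_functional).
HB.instance Definition _ := GRing.isLinear.Build R U R^o *:%R f (asboolW fP).
Definition dual_Sub : dual := f.
End Sub.

Lemma dual_rect (K : dual -> Type) :
  (forall f (fP : f \in linear_functional), K (dual_Sub fP)) ->
  forall u : dual, K u.
Proof.
move=> Ksub u; have uP : (u : U -> R^o) \in linear_functional.
  by apply/asboolP => a x y; exact: linearP.
suff -> : u = dual_Sub uP by exact: Ksub.
case: u uP => f [[fN] [fZ]] uP; rewrite /dual_Sub /=.
by congr GRing.Linear.Pack; congr GRing.Linear.Class;
  [congr Algebra.isNmodMorphism.Axioms_ | congr GRing.isScalable.Axioms_];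
  exact: Prop_irrelevance.
Qed.

Lemma dual_SubK f (fP : f \in linear_functional) :
  dual_Sub fP = f :> (U -> R^o).
Proof. by []. Qed.

HB.instance Definition _ :=
  isSub.Build (U -> R^o) linear_functional dual dual_rect dual_SubK.
HB.instance Definition _ := [Choice of dual by <:].

Lemma linear_functional_closed : submod_closed linear_functional.
Proof.
split=> [|a f g /asboolP fL /asboolP gL]; apply/asboolP => b u v.
  by rewrite /GRing.zero /= scaler0 addr0.
rewrite [LHS]/GRing.add /= [X in X + _]/GRing.scale /= fL gL.
rewrite [in RHS]/GRing.add /= ![(a *: f) _]/GRing.scale /=.
by rewrite !scalerDr addrACA !scalerA mulrC.
Qed.

HB.instance Definition _ := GRing.isSubmodClosed.Build R (U -> R^o)
  linear_functional linear_functional_closed.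
HB.instance Definition _ := [SubChoice_isSubZmodule of dual by <:].
HB.instance Definition _ := [SubZmodule_isSubLmodule of dual by <:].

End Dual.

Section Bidual.
Variables (R : comPzRingType) (U : lmodType R).

Section Eval.
Variable u : U.

Definition dual_eval (f : dual U) : R^o := f u.

Lemma dual_eval_is_linear : linear dual_eval.
Proof. by []. Qed.

HB.instance Definition _ :=
  GRing.isLinear.Build R (dual U) R^o *:%R dual_eval dual_eval_is_linear.
End Eval.

Definition bidual_map (u : U) : dual (dual U) := dual_eval u.

Lemma bidual_map_is_linear : linear bidual_map.
Proof.
by move=> a u v; apply/val_inj/funext => f; exact: linearP.
Qed.

HB.instance Definition _ := GRing.isLinear.Build R U (dual (dual U)) *:%R
  bidual_map bidual_map_is_linear.

End Bidual.

Section ProbeModel.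
Variables (R : realType) (X : Type) (H : vectType R) (h : X -> H).
Variable V : {vspace 'Hom(H, R^o)}.

Definition concept_pred : {pred X -> R^o} :=
  fun c => `[< exists2 l, l \in V & c = l \o h >].

Lemma concept_pred_closed : submod_closed concept_pred.
Proof.
split=> [|a _ _ /asboolP[l lV ->] /asboolP[m mV ->]]; apply/asboolP.
  by exists 0; [exact: mem0v | apply/funext => x; rewrite /= lfunE].
exists (a *: l + m); first exact: memvD (memvZ _ lV) mV.
by apply/funext => x; rewrite /= add_lfunE scale_lfunE.
Qed.

Definition concept_family : subspace (X -> R^o) := Subspace concept_pred_closed.

Definition invisible_pred : {pred H} :=
  fun v => `[< forall l, l \in V -> v \in lker l >].

Lemma invisible_pred_closed : submod_closed invisible_pred.
Proof.
split=> [|a u v /asboolP uK /asboolP vK]; apply/asboolP => l lV.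
  exact: mem0v.
exact: memvD (memvZ _ (uK l lV)) (vK l lV).
Qed.

Definition probe_invisible : subspace H := Subspace invisible_pred_closed.

Definition probe_visible := quot_space probe_invisible.

HB.instance Definition _ := ZmodQuotient.on probe_visible.
HB.instance Definition _ := GRing.Lmodule.on probe_visible.

Lemma concept_familyP C (VC : concept_family = C) (l : subvs_of V) :
  vsval l \o h \in C.
Proof. by rewrite -VC; apply/asboolP; exists (vsval l); rewrite ?subvsP. Qed.

(* The evaluation map [E], with the concept family [C] it maps onto given up to
   equality, so that models with the same family share one codomain. *)
Definition eval_map C (VC : concept_family = C) (l : subvs_of V) :
  subspace_of C := SubspaceOf (concept_familyP VC l).

End ProbeModel.

Section PointEvaluation.
Variables (R : realType) (X : Type) (C : subspace (X -> R^o)) (x : X).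

Definition point_eval (c : subspace_of C) : R^o := subspace_val c x.

Lemma point_eval_is_linear : linear point_eval.
Proof. by []. Qed.

HB.instance Definition _ := GRing.isLinear.Build R (subspace_of C) R^o *:%R
  point_eval point_eval_is_linear.

Definition ev : dual (subspace_of C) := point_eval.

End PointEvaluation.

(* Main.v *)
(* Since [E] is a bijection from [V] onto [C], the only candidate for [Q v] is
   evaluation at [v] of the probe [E^-1 c], and its kernel is [K(V)]. [Q] is
   onto by finite dimension: the values of a functional on the concepts of a
   basis of [V] are attained by the probes of that basis at a common vector,
   because independent functionals on [H] take arbitrary prescribed values. *)

Require Import Defs.
From HB Require Import structures.
From mathcomp Require Import all_boot all_order all_algebra.
From mathcomp Require Import generic_quotient ring_quotient.
From mathcomp Require Import boolp classical_sets functions reals.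

Set Implicit Arguments.
Unset Strict Implicit.
Unset Printing Implicit Defensive.

Import GRing.Theory.

Local Open Scope ring_scope.
Local Open Scope quotient_scope.

(** * Linear maps: packing, extensionality, isomorphisms *)

Definition linear_of (R : pzRingType) (U W : lmodType R) (f : U -> W)
    (fL : linear f) : {linear U -> W} :=
  HB.pack f (GRing.isLinear.Build R U W *:%R f fL).

(** Once the functions agree, the packed records differ only in proofs, which proof irrelevance
    identifies. This covers equality in [dual] as well. *)
Lemma linear_ext (R : pzRingType) (U W : lmodType R) (f g : {linear U -> W}) :
  f =1 g -> f = g.
Proof.
move=> /funext; case: f => f [[fN] [fZ]]; case: g => g [[gN] [gZ]] /= fg.
case: _ / fg in gN gZ *.
by congr GRing.Linear.Pack; congr GRing.Linear.Class;
  [congr Algebra.isNmodMorphism.Axioms_ | congr GRing.isScalable.Axioms_];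
  exact: Prop_irrelevance.
Qed.

(** Choice turns surjectivity into a right inverse, and injectivity makes it a left inverse too. *)
Lemma inj_surj_bij (A B : Type) (f : A -> B) :
  injective f -> (forall b, exists a, f a = b) -> bijective f.
Proof.
move=> fI /choice[g gK]; exists g => // a; exact/fI/gK.
Qed.

Lemma linear_iso_factor (R : pzRingType) (U1 U2 W : lmodType R)
    (f : {linear U1 -> W}) (g : {linear U2 -> W}) :
  bijective f -> bijective g ->
  exists phi : {linear U1 -> U2}, bijective phi /\ forall u, g (phi u) = f u.
Proof.
move=> f_bij [g' gK g'K].
have gfL : linear (g' \o f).
  (* Both sides are compared after applying the injective [g], which cancels [g']. *)
  by move=> a u v; apply: (can_inj gK); rewrite linearP /= !g'K linearP.
exists (linear_of gfL); split=> [|u]; last exact: g'K.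
by apply: bij_comp => //; exists g.
Qed.

(** * Factoring a linear map through the quotient by its kernel *)

Section Quotient.
Variables (R : pzRingType) (U W : lmodType R) (S : subspace U).
Variable f : {linear U -> W}.
Hypothesis f_ker : forall u, f u = 0 <-> u \in S.

(** The chosen representative differs from [u] by an element of [S], on which [f] vanishes. *)
Lemma quot_liftE u : f (repr (\pi_(quot_space S) u)) = f u.
Proof.
apply/eqP; rewrite -subr_eq0 -linearB; apply/eqP/f_ker.
by rewrite Quotient.idealrBE reprK.
Qed.

Lemma quot_lift_linear : linear (fun z : quot_space S => f (repr z)).
Proof.
move=> a; elim/quotW=> u; elim/quotW=> v.
rewrite [_ *: _](_ : _ = \pi_(quot_space S) (a *: u)); last by rewrite pi_scale.
by rewrite -raddfD !quot_liftE linearP.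
Qed.

Definition quot_lift : {linear quot_space S -> W} := linear_of quot_lift_linear.

Lemma quot_lift_inj : injective quot_lift.
Proof.
elim/quotW=> u; elim/quotW=> v; rewrite /= !quot_liftE => fuv.
by apply/eqP; rewrite -Quotient.idealrBE; apply/f_ker; rewrite linearB fuv subrr.
Qed.

End Quotient.

(** * Biduals, and interpolation by functionals *)

Lemma dual_sumE (R : comPzRingType) (U : lmodType R) (I : finType)
    (f : I -> dual U) u : (\sum_i f i) u = \sum_i f i u.
Proof. exact: (raddf_sum (dual_eval u)). Qed.

(** The values [d i u] determine [u], whence injectivity. Every [f] is the combination of the [d i]
    with coefficients [f (e i)], so [F] is evaluation at the combination of the [e i] with
    coefficients [F (d i)]. *)
Lemma bidual_map_bij (R : comPzRingType) (U : lmodType R) (n : nat)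
    (e : 'I_n -> U) (d : 'I_n -> dual U) :
  (forall u, u = \sum_i d i u *: e i) -> bijective (@bidual_map R U).
Proof.
move=> eK; apply: inj_surj_bij => [u v uv | F].
  rewrite (eK u) (eK v); apply: eq_bigr => i _; congr (_ *: _).
  by have := congr1 (fun F : dual (dual U) => F (d i)) uv.
have dK (f : dual U) : f = \sum_i (f (e i) : R) *: d i.
  apply: linear_ext => u; rewrite [RHS]dual_sumE.
  rewrite [in LHS](eK u) linear_sum; apply: eq_bigr => i _.
  by rewrite linearZ; exact: mulrC.
exists (\sum_i (F (d i) : R) *: e i); apply: linear_ext => f.
rewrite -[LHS]/(f _) [in RHS](dK f) !linear_sum.
by apply: eq_bigr => i _; rewrite !linearZ; exact: mulrC.
Qed.

(* The matrix of the functionals in [b] has independent rows, hence a right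
   inverse. *)
Lemma free_functionals_interp (K : fieldType) (H : vectType K) (n : nat)
    (b : n.-tuple 'Hom(H, K^o)) (w : 'I_n -> K) :
  free b -> exists v : H, forall i : 'I_n, b`_i v = w i.
Proof.
move=> /freeP b_free; pose e := vbasis {:H}.
pose M : 'M[K]_(n, \dim {:H}) := \matrix_(i, j) (b`_i e`_j : K).
have M_free : row_free M.
  (* A row [u] with [u *m M = 0] gives a combination of the functionals in [b] that vanishes on the
     basis [e], hence everywhere; freeness then forces [u = 0]. *)
  rewrite -kermx_eq0; apply/rowV0P => u /sub_kermxP uM.
  apply/rowP => i; rewrite [RHS]mxE; apply: (b_free (u 0)).
  apply/lfunP => v; rewrite (coord_vbasis (memvf v)) !linear_sum.
  apply: eq_bigr => j _; rewrite !linearZ; congr (_ *: _).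
  have /rowP/(_ j) := uM; rewrite !mxE => uM0.
  rewrite /= sum_lfunE zero_lfunE -[RHS]uM0; apply: eq_bigr => k _.
  by rewrite scale_lfunE mxE.
(* A solution of the linear system with matrix [M] and right-hand side [w]; its entries are the
   coordinates in [e] of the required vector. *)
pose x := pinvmx M *m \col_i w i.
exists (\sum_j x j 0 *: e`_j) => i.
have := congr1 (fun A : 'cV_ _ => A i 0) (mulmxA M (pinvmx M) (\col_i w i)).
rewrite mulmxVp // mul1mx -/x !mxE => <-.
rewrite linear_sum; apply: eq_bigr => j _.
by rewrite linearZ [M _ _]mxE; exact: mulrC.
Qed.

(** * The map Q of a single model *)

Section Model.
Variables (R : realType) (X : Type) (H : vectType R) (h : X -> H).
Variables (V : {vspace 'Hom(H, R^o)}) (C : subspace (X -> R^o)).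
Hypothesis VC : concept_family h V = C.
Hypothesis E_inj : injective (eval_map VC).
Local Notation E := (eval_map VC).

Lemma eval_map_linear : linear E.
Proof.
move=> a l m; apply/val_inj/funext => x.
rewrite -[LHS]/(vsval (a *: l + m) (h x)) linearP.
by rewrite add_lfunE scale_lfunE.
Qed.

Lemma eval_map_surj (c : subspace_of C) : exists l, E l = c.
Proof.
have := valP c; rewrite -[X in _ \in subspace_pred X]VC => /asboolP[l lV cE].
by exists (Subvs lV); apply/val_inj.
Qed.

(** The inverse of [E], given by a choice of preimages; injectivity of [E] makes it two-sided and
    linear. *)
Definition probe_of (c : subspace_of C) : subvs_of V :=
  projT1 (cid (eval_map_surj c)).

Lemma probe_ofK : cancel probe_of E.
Proof. by move=> c; rewrite /probe_of; case: cid. Qed.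

Lemma eval_mapK : cancel E probe_of.
Proof. by move=> l; apply: E_inj; rewrite probe_ofK. Qed.

Lemma probe_of_linear : linear probe_of.
Proof.
by move=> a c d; apply: E_inj; rewrite eval_map_linear !probe_ofK.
Qed.

Lemma probe_apply_linear (v : H) :
  linear (fun c => vsval (probe_of c) v : R^o).
Proof.
by move=> a c d; rewrite probe_of_linear linearP /= add_lfunE scale_lfunE.
Qed.

Definition probe_apply (v : H) : dual (subspace_of C) :=
  linear_of (probe_apply_linear v).

Lemma probe_apply_is_linear : linear probe_apply.
Proof. by move=> a u v; apply: linear_ext => c; exact: linearP. Qed.

Definition quot_map : {linear H -> dual (subspace_of C)} :=
  linear_of probe_apply_is_linear.

Lemma quot_mapE v l : quot_map v (E l) = vsval l v.
Proof. by rewrite /= eval_mapK. Qed.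

(** Since [E] is onto, the equation prescribes the value of [P v] at every concept. *)
Lemma quot_map_uniq (P : {linear H -> dual (subspace_of C)}) :
  (forall v l, P v (E l) = vsval l v) -> quot_map = P.
Proof.
move=> PE; apply: linear_ext => v; apply: linear_ext => c.
by rewrite -(probe_ofK c) [LHS]quot_mapE [RHS]PE.
Qed.

Lemma quot_map_ev x : quot_map (h x) = ev C x.
Proof.
by apply: linear_ext => c; rewrite -(probe_ofK c) [LHS]quot_mapE.
Qed.

Lemma quot_map_ker v : quot_map v = 0 <-> v \in probe_invisible V.
Proof.
split=> [Qv0 | /asboolP vK].
  apply/asboolP => l lV; rewrite memv_ker.
  by rewrite -[l]/(vsval (Subvs lV)) -quot_mapE Qv0.
apply: linear_ext => c; rewrite -(probe_ofK c) [LHS]quot_mapE.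
by apply/eqP; rewrite -memv_ker vK ?subvsP.
Qed.

Local Notation basis_probe i := (vsproj V (vbasis V)`_i).

Lemma basis_probe_coord (l : subvs_of V) :
  l = \sum_i coord (vbasis V) i (vsval l) *: basis_probe i.
Proof.
apply/val_inj; rewrite /= {1}(coord_vbasis (subvsP l)) linear_sum.
apply: eq_bigr => i _.
by rewrite linearZ /= vsprojK // vbasis_mem ?mem_nth ?size_tuple.
Qed.

Lemma eval_map_coord l :
  E l = \sum_i coord (vbasis V) i (vsval l) *: E (basis_probe i).
Proof.
rewrite -[LHS]/(linear_of eval_map_linear l) {1}[l]basis_probe_coord linear_sum.
by apply: eq_bigr => i _; rewrite linearZ.
Qed.

Lemma quot_map_surj f : exists v, quot_map v = f.
Proof.
(* Each basis probe takes at [v] the value of [f] on its concept; linearity extends the agreement to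
   all of [C]. *)
have [v vE] := free_functionals_interp (fun i => f (E (basis_probe i)))
  (basis_free (vbasisP V)).
exists v; apply: linear_ext => c; rewrite -(probe_ofK c) [LHS]quot_mapE.
move: (probe_of c) => l; rewrite {1}(coord_vbasis (subvsP l)) sum_lfunE.
rewrite eval_map_coord linear_sum; apply: eq_bigr => i _.
by rewrite scale_lfunE vE linearZ.
Qed.

(** The coordinates of a probe serve as coordinates of its concept, which supplies the finite
    expansion needed for the bidual of [C]. *)
Lemma concept_coord_linear i :
  linear (fun c => coord (vbasis V) i (vsval (probe_of c)) : R^o).
Proof. by move=> a c d; rewrite probe_of_linear !linearP. Qed.

Lemma concept_bidual_bij : bijective (@bidual_map R (subspace_of C)).
Proof.
apply: (@bidual_map_bij _ _ _ (fun i => E (basis_probe i))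
  (fun i => linear_of (concept_coord_linear i))) => c.
by rewrite -{1}(probe_ofK c) eval_map_coord.
Qed.

End Model.

Theorem theorem3p3 (R : realType) (X : Type)
    (H : 'I_2 -> vectType R) (h : forall i, X -> H i)
    (V : forall i, {vspace 'Hom(H i, R^o)})
    (C : subspace (X -> R^o))
    (VC : forall i, concept_family (h i) (V i) = C)
    (E_inj : forall i, injective (eval_map (VC i))) :
  exists Q : forall i, {linear H i -> dual (subspace_of C)},
  [/\ forall i, unique (fun P : {linear H i -> dual (subspace_of C)} =>
        forall (v : H i) (l : subvs_of (V i)),
          P v (eval_map (VC i) l) = vsval l v) (Q i),
      forall i (x : X), Q i (h i x) = ev C x,
      forall i (v : H i), Q i v = 0 <-> v \in probe_invisible (V i),
      exists Qbar :
          forall i, {linear probe_visible (V i) -> dual (subspace_of C)},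
        [/\ forall i (v : H i), Qbar i (\pi_(probe_visible (V i)) v) = Q i v,
            forall i, bijective (Qbar i)
          & exists phi :
              {linear probe_visible (V ord0) -> probe_visible (V ord_max)},
              bijective phi /\
              forall z, Qbar ord_max (phi z) = Qbar ord0 z]
    & bijective (@bidual_map R (subspace_of C))].
Proof.
pose Q i := quot_map (@E_inj i).
have Q_ker i v : Q i v = 0 <-> v \in probe_invisible (V i) by exact: quot_map_ker.
pose Qbar i : {linear probe_visible (V i) -> _} := quot_lift (Q_ker i).
have Qbar_bij i : bijective (Qbar i).
  apply: inj_surj_bij => [|f]; first exact: quot_lift_inj.
  have [v <-] := quot_map_surj (@E_inj i) f.
  (* The class of a preimage under [Q i] is a preimage under [Qbar i]. *)
  by exists (\pi_(probe_visible (V i)) v); exact: (quot_liftE (Q_ker i)).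
exists Q; split=> //.
- move=> i; split=> [v l | P PE]; [exact: quot_mapE | exact: quot_map_uniq].
- by move=> i x; exact: quot_map_ev.
- exists Qbar; split=> // [i v|]; first exact: (quot_liftE (Q_ker i)).
  exact: (linear_iso_factor (Qbar_bij ord0) (Qbar_bij ord_max)).
(* Either model gives finite coordinates on [C]; the first one is taken. *)
- exact: (concept_bidual_bij (@E_inj ord0)).
Qed.
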